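(* Let $D\subset\mathbb{R}^n$, let $T=\{t_1,\ldots,t_s\}$ be a finite set, and let $f: D\to T$ be a function. Then $f$ is a semilinear function if and only if it is a linear logical function.
   Context: Semilinear functions. Semilinear sets are the subsets of $\mathbb{R}^n$ that are finite unions of sets of the form $\{x\in\mathbb{R}^n: f_1(x)=\cdots=f_k(x)=0,\ g_1(x)>0,\ldots,g_l(x)>0\}$ where the $f_i$ and $g_j$ are affine linear functions. A function $f:D\to T$ on $D\subset\mathbb{R}^n$, with $T$ a discrete set, is semilinear if for every $t\in T$ the set $f^{-1}\{t\}$ equals the intersection of $D$ with a semilinear set. Linear logical functions. For an affine linear function $l=(l_1,\ldots,l_k)$ on $\mathbb{R}^n$, the chambers of $l$ are the regions into which $\mathbb{R}^n$ is subdivided by the hyperplanes $\{l_i=0\}$; they are defined to contain some of their boundary strata in such a way that they are disjoint and their union is $\mathbb{R}^n$ (concretely: the nonempty sets obtained by imposing, for each $i$, either $l_i\ge 0$ or $l_i<0$). Let $D\subset\mathbb{R}^n$ and let $T$ be a finite set. A linear logical graph $(G,L)$ consists of a finite directed graph $G$ (parallel arrows allowed) with no oriented cycle, with exactly one source vertex (vertex with no incoming arrow) and exactly $|T|$ target vertices (vertices with no outgoing arrow), identified with the elements of $T$, together with a collection $L=\{l_v\}$ of affine linear functions on $\mathbb{R}^n$, one for each vertex $v$ having more than one outgoing arrow, such that the chambers of $l_v$ are in one-to-one correspondence with the outgoing arrows of $v$. It determines a function $f_{G,L}: D\to T$: given $x\in D$, start at the source vertex; at a vertex with exactly one outgoing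 arrow follow that arrow; at a vertex $v$ with more than one outgoing arrow follow the arrow corresponding to the chamber of $l_v$ containing $x$; this stops at a target vertex, and $f_{G,L}(x)\in T$ is the element associated to it. A function $D\to T$ is a linear logical function if it equals $f_{G,L}$ for some linear logical graph $(G,L)$. *)

(* Defs.v *)
From HB Require Import structures.
From mathcomp Require Import all_boot all_order all_algebra.
From mathcomp Require Import boolp classical_sets functions reals.

Set Implicit Arguments.
Unset Strict Implicit.
Unset Printing Implicit Defensive.
Import Order.TTheory GRing.Theory Num.Theory.
Local Open Scope classical_set_scope.
Local Open Scope ring_scope.

Definition affine_linear (R : realType) (U V : lmodType R) (f : U -> V) : Prop :=
  exists (g : {linear U -> V}) (b : V), forall x, f x = g x + b.

(** * Semilinear sets and functions *)

Definition basic_semilinear_set (R : realType) (n : nat)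
    (A : set 'rV[R]_n) : Prop :=
  exists (k l : nat) (f : 'I_k -> 'rV[R]_n -> R^o) (g : 'I_l -> 'rV[R]_n -> R^o),
    [/\ forall i, affine_linear (f i),
        forall j, affine_linear (g j) &
        A = [set x | (forall i, f i x = 0) /\ (forall j, 0 < g j x)]].

Definition semilinear_set (R : realType) (n : nat) (A : set 'rV[R]_n) : Prop :=
  exists (m : nat) (B : 'I_m -> set 'rV[R]_n),
    (forall i, basic_semilinear_set (B i)) /\ A = \bigcup_i B i.

(* The domain [D] is coerced to the type of its points, so [f @^-1` [set t]] is
   a set of points of [D]; [val] embeds it back into the ambient space. *)
Definition semilinear_function (R : realType) (n : nat) (D : set 'rV[R]_n)
    (T : Type) (f : D -> T) : Prop :=
  forall t : T, exists S : set 'rV[R]_n,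
    semilinear_set S /\ val @` (f @^-1` [set t]) = D `&` S.

(** * Chambers *)

Definition chambers (R : realType) (n k : nat) (l : 'rV[R]_n -> 'rV[R]_k) :
    set (set 'rV[R]_n) :=
  [set C | C !=set0 /\
    exists s : 'I_k -> bool,
      C = [set x | forall i, if s i then 0 <= l x 0 i else l x 0 i < 0]].

(** * Finite directed multigraphs *)

Record digraph := Digraph {
  vertex : finType;
  arrow : finType;
  tail : arrow -> vertex;
  head : arrow -> vertex
}.

Definition outgoing (G : digraph) (v : vertex G) : {set arrow G} :=
  [set a | tail a == v]%SET.

Definition incoming (G : digraph) (v : vertex G) : {set arrow G} :=
  [set a | head a == v]%SET.

Definition composable (G : digraph) : rel (arrow G) :=
  fun a b => head a == tail b.

(* [cycle] also holds of the empty sequence of arrows. *)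
Definition no_oriented_cycle (G : digraph) : Prop :=
  forall p : seq (arrow G), cycle (@composable G) p -> p = [::].

(** * Linear logical graphs *)

(* [lfun] and [chamber_of] are total for convenience: [lfun v] is only used at
   vertices [v] with more than one outgoing arrow, and [chamber_of a] only when
   [tail a] is such a vertex; their other values are irrelevant. *)
Record linear_logical_graph (R : realType) (n : nat) (T : finType) :=
    LinearLogicalGraph {
  graph :> digraph;
  graph_acyclic : no_oriented_cycle graph;
  source : vertex graph;
  sourceP : forall v, #|incoming v| = 0%N <-> v = source;
  target : T -> vertex graph;
  target_inj : injective target;
  targetP : forall v, #|outgoing v| = 0%N <-> exists t, v = target t;
  ldim : vertex graph -> nat;
  lfun : forall v, 'rV[R]_n -> 'rV[R]_(ldim v);
  lfun_affine : forall v, (1 < #|outgoing v|)%N -> affine_linear (@lfun v);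
  chamber_of : arrow graph -> set 'rV[R]_n;
  chamber_ofP : forall v, (1 < #|outgoing v|)%N ->
    set_bij [set` outgoing v] (chambers (@lfun v)) chamber_of
}.

Definition follows (R : realType) (n : nat) (T : finType)
    (G : linear_logical_graph R n T) (x : 'rV[R]_n) (a : arrow G) : Prop :=
  #|outgoing (tail a)| = 1%N \/
  (1 < #|outgoing (tail a)|)%N /\ chamber_of a x.

(* [stops_at G x v t]: the walk directed by [x] and started at the vertex [v]
   stops at the target vertex [t]. *)
Inductive stops_at (R : realType) (n : nat) (T : finType)
    (G : linear_logical_graph R n T) (x : 'rV[R]_n) : vertex G -> T -> Prop :=
| stops_here t : stops_at x (target G t) t
| stops_later a t :
    follows x a -> stops_at x (head a) t -> stops_at x (tail a) t.

Lemma chambers_cover (R : realType) (n k : nat) (l : 'rV[R]_n -> 'rV[R]_k) x :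
  exists2 C, chambers l C & C x.
Proof.
pose C := [set y | forall i, if 0 <= l x 0 i then 0 <= l y 0 i else l y 0 i < 0].
have Cx : C x by move=> i; case: leP.
exists C => //; split; first by exists x.
by exists (fun i => 0 <= l x 0 i).
Qed.

Lemma chambers_disjoint (R : realType) (n k : nat) (l : 'rV[R]_n -> 'rV[R]_k)
    C C' x :
  chambers l C -> chambers l C' -> C x -> C' x -> C = C'.
Proof.
move=> [_ [s ->]] [_ [s' ->]] /= Cx Cx'.
suff -> : s = s' by [].
apply/funext => i; move: (Cx i) (Cx' i).
by case: (s i); case: (s' i) => //; case: leP.
Qed.

Section Walk.
Context (R : realType) (n : nat) (T : finType) (G : linear_logical_graph R n T).
Context (x : 'rV[R]_n).

Lemma follows_exists (v : vertex G) :
  #|outgoing v| <> 0%N -> exists2 a : arrow G, tail a = v & follows x a.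
Proof.
move=> v0; have [v1|v1] := ltnP 1 #|outgoing v|.
  have [C lC Cx] := chambers_cover (@lfun _ _ _ G v) x.
  have [_ _ /(_ _ lC) [a /= av aC]] := chamber_ofP v1.
  move: av; rewrite inE => /eqP av; exists a => //; right.
  by rewrite av aC.
have v1' : #|outgoing v| = 1%N by apply/eqP; rewrite eqn_leq v1 lt0n; apply/eqP.
have /card_gt0P[a] : (0 < #|outgoing v|)%N by rewrite v1'.
by rewrite inE => /eqP av; exists a => //; left; rewrite av.
Qed.

Lemma follows_unique (a b : arrow G) :
  tail a = tail b -> follows x a -> follows x b -> a = b.
Proof.
move=> ab; rewrite /follows ab.
have aO : a \in outgoing (tail b) by rewrite inE ab.
have bO : b \in outgoing (tail b) by rewrite inE.
case=> [/eqP/cards1P[c Oc] _|[b1 ax] [b1'|[_ bx]]].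
- by move: aO bO; rewrite Oc !inE => /eqP -> /eqP ->.
- by rewrite b1' in b1.
have [ch inj _] := chamber_ofP b1.
apply: inj; rewrite ?inE //=.
exact: (chambers_disjoint (ch _ aO) (ch _ bO) ax bx).
Qed.

Lemma path_uniq (p : seq (arrow G)) : sorted (@composable G) p -> uniq p.
Proof.
elim: p => //= a p IH pa; rewrite IH ?(path_sorted pa) // andbT.
apply/negP => /splitPr ap; case: ap pa => p1 p2.
rewrite cat_path /= => /and3P[pp1 last1 _].
have : cycle (@composable G) (a :: p1) by rewrite /= rcons_path pp1.
by move/graph_acyclic.
Qed.

Lemma stops_at_exists (v : vertex G) : exists t, stops_at x v t.
Proof.
suff H m : forall (w : vertex G) (p : seq (arrow G)),
    sorted (@composable G) p ->
    (forall a, tail a = w -> sorted (@composable G) (rcons p a)) ->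
    (#|arrow G| - size p <= m)%N -> exists t, stops_at x w t.
  exact: (H _ v [::]).
elim: m => [|m IH] w p sp wp szp.
all: have [/targetP[t ->]|w0] := pselect (#|outgoing w| = 0%N);
  first by exists t; exact: stops_here.
all: have [a aw fa] := follows_exists w0.
all: have := wp a aw => spa; have := path_uniq spa => /card_uniqP upa.
all: have := max_card (mem (rcons p a)); rewrite upa size_rcons => szpa.
  by move: szp; rewrite leqn0 subn_eq0 leqNgt szpa.
have szm : (#|arrow G| - size (rcons p a) <= m)%N.
  by rewrite size_rcons subnS; case: (_ - _)%N szp.
have step b : tail b = head a -> sorted (@composable G) (rcons (rcons p a) b).
  move=> ba; case: p {sp wp szp upa szpa szm} spa => [|c p] /=.
    by rewrite andbT => _; apply/eqP.
  by move=> spa; rewrite rcons_path spa last_rcons; apply/eqP.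
have [t st] := IH (head a) (rcons p a) spa step szm.
by exists t; rewrite -aw; exact: stops_later st.
Qed.

Lemma stops_at_unique (v : vertex G) (t t' : T) :
  stops_at x v t -> stops_at x v t' -> t = t'.
Proof.
have sink u (a : arrow G) : target G u <> tail a.
  move=> ua; have : #|outgoing (tail a)| = 0%N by apply/targetP; exists u.
  by move/cards0_eq/setP/(_ a); rewrite !inE eqxx.
move=> st; elim: st t' => {v t} [t|a t fa _ IH] t' st.
  by move: st; move E : (target G t) => v st; case: st E => [u /target_inj|b u _ _ /sink].
move E : (tail a) st => v st; case: st E => [u /esym/sink //|b u fb st ab].
by apply: IH; rewrite (follows_unique ab fa fb).
Qed.

End Walk.

Definition logical_value (R : realType) (n : nat) (T : finType)
    (G : linear_logical_graph R n T) (x : 'rV[R]_n) : T :=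
  projT1 (cid (stops_at_exists x (source G))).

Lemma logical_valueP (R : realType) (n : nat) (T : finType)
    (G : linear_logical_graph R n T) (x : 'rV[R]_n) (t : T) :
  logical_value G x = t <-> stops_at x (source G) t.
Proof.
rewrite /logical_value; case: cid => u su /=; split=> [<- //|].
exact: stops_at_unique.
Qed.

Definition linear_logical_function (R : realType) (n : nat) (D : set 'rV[R]_n)
    (T : finType) (f : D -> T) : Prop :=
  exists G : linear_logical_graph R n T,
    f = fun x : D => logical_value G (val x).

(* Main.v *)
Require Import Defs.
From HB Require Import structures.
From mathcomp Require Import all_boot all_order all_algebra.
From mathcomp Require Import boolp classical_sets functions reals.

(** Both notions say that the value at a point depends only on the signs of
finitely many affine functions there.

A set is semilinear if and only if membership in it depends only on the truth
values of finitely many inequalities [0 <= g i x] with [g i] affine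
([semilinear_sign_determined], [sign_determined_semilinear]): an equation or a
strict inequality can be read off from such tests, and conversely a
set that is determined by the signs of the [g i] is the union of the
finitely many cells on which each [g i] is negative, zero or positive that it
contains.

The walk of a linear logical graph only looks at the signs of the components of
the affine functions at its vertices, so the set of points where it stops at a
given target is determined by signs, hence semilinear
([logical_value_sign_determined]).

Conversely, let [f] be semilinear. Gather in one affine map [l] all
the affine functions that determine the preimages of [f]. Then [f] factors
through the chamber of [l], and one decision vertex labelled by [l] would compute
it, except that a value not taken by [f] would give a target without incoming
arrow, that is a second source. This is repaired by testing [l] twice: the
source has one arrow to an intermediate vertex for each chamber [c], and this
vertex has one arrow for each chamber [d]. The walk only takes the arrows with
[d = c], which lead to the value of [f] on [c]. The others are never taken, and
they are used to reach all targets, which is possible once [l] has more than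
[#|T|] chambers; this is arranged by adding to [l] translates of a coordinate
function. *)

Set Implicit Arguments.
Unset Strict Implicit.
Unset Printing Implicit Defensive.
Import Order.TTheory GRing.Theory Num.Theory.
Local Open Scope classical_set_scope.
Local Open Scope ring_scope.

(** * Affine linear functions *)

Section Affine.
Context (R : realType).

Lemma affine_linearI (U V : lmodType R) (f g : U -> V) (b : V) :
  linear g -> (forall x, f x = g x + b) -> affine_linear f.
Proof.
move=> lin_g fE.
pose g_lin := GRing.isLinear.Build R U V _ g lin_g.
by exists (HB.pack g g_lin : {linear U -> V}), b.
Qed.

Lemma affine_linear_cst (U V : lmodType R) (b : V) :
  affine_linear (fun _ : U => b).
Proof.
apply: (@affine_linearI _ _ _ (fun=> 0) b) => [a x y|x].
  by rewrite scaler0 addr0.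
by rewrite add0r.
Qed.

Lemma affine_linearN (U V : lmodType R) (f : U -> V) :
  affine_linear f -> affine_linear (fun x => - f x).
Proof.
move=> [g [b fE]].
apply: (@affine_linearI _ _ _ (fun x => - g x) (- b)) => [a x y|x].
  by rewrite linearP opprD scalerN.
by rewrite fE opprD.
Qed.

Lemma affine_linear_coord (U : lmodType R) (k : nat) (f : U -> 'rV[R]_k) i :
  affine_linear f -> affine_linear (fun x => f x 0 i : R^o).
Proof.
move=> [g [b fE]].
apply: (@affine_linearI _ _ _ (fun x => g x 0 i : R^o) (b 0 i)) => [a x y|x].
  by rewrite linearP !mxE.
by rewrite fE mxE.
Qed.

Lemma affine_linear_row (U : lmodType R) (k : nat) (f : 'I_k -> U -> R^o) :
  (forall i, affine_linear (f i)) -> affine_linear (fun x => \row_i f i x).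
Proof.
move=> /choice[g] /choice[b fE].
apply: (@affine_linearI _ _ _ (fun x => \row_i g i x) (\row_i b i)).
  by move=> a x y; apply/rowP => i; rewrite !mxE linearP.
by move=> x; apply/rowP => i; rewrite !mxE fE.
Qed.

Lemma affine_linear_subr (n : nat) (i : 'I_n) (a : R) :
  affine_linear (fun x : 'rV[R]_n => x 0 i - a : R^o).
Proof.
apply: (@affine_linearI _ _ _ (fun x : 'rV[R]_n => x 0 i : R^o) (- a)) => //.
by move=> c x y; rewrite !mxE.
Qed.

End Affine.

(** * Semilinear sets as unions of sign cells *)

Section SignDetermined.
Context (R : realType) (n : nat).
Implicit Types (A : set 'rV[R]_n) (x y : 'rV[R]_n).

Definition same_signs (I : Type) (g : I -> 'rV[R]_n -> R^o) x y : Prop :=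
  forall i, (0 <= g i x) = (0 <= g i y).

(** Testing only [0 <= g i x] loses nothing, since the finer sign is recovered by
adding [- g i] to the family; these are also the tests that define
chambers. *)
Definition sign_determined A : Prop :=
  exists (I : finType) (g : I -> 'rV[R]_n -> R^o),
    (forall i, affine_linear (g i)) /\
    forall x y, same_signs g x y -> A x -> A y.

(** The disjoint union of the families that determine each of the sets determines
all of them at once. *)
Lemma sign_determined_family (I : finType) (A : I -> set 'rV[R]_n) :
  (forall i, sign_determined (A i)) ->
  exists (J : finType) (g : J -> 'rV[R]_n -> R^o),
    (forall j, affine_linear (g j)) /\
    forall x y, same_signs g x y -> forall i, A i x -> A i y.
Proof.
move=> detA.
have /choice[W WP] (i : I) : exists W : {J : finType & J -> 'rV[R]_n -> R^o},
    (forall j, affine_linear (tagged W j)) /\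
    forall x y, same_signs (tagged W) x y -> A i x -> A i y.
  by have [J [g gP]] := detA i; exists (Tagged _ g).
exists {i : I & tag (W i)}, (fun u => tagged (W (tag u)) (tagged u)).
split=> [u|x y sxy i]; first exact: (WP _).1.
by apply: (WP i).2 => j; exact: (sxy (Tagged (fun i => tag (W i)) j)).
Qed.

(** An equation [f = 0] is detected by the tests [0 <= f] and [0 <= - f], and
[0 < g] is the failure of [0 <= - g]. *)
Lemma basic_semilinear_sign_determined A :
  basic_semilinear_set A -> sign_determined A.
Proof.
move=> [k [l [f [g [fa ga ->]]]]].
exists ('I_k + 'I_k + 'I_l)%type, (fun u => match u with
  | inl (inl i) => f i
  | inl (inr i) => fun x => - f i x
  | inr j => fun x => - g j x
  end); split=> [[[i|i]|j]|x y sxy /= [fx gx]].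
- exact: fa.
- exact/affine_linearN/fa.
- exact/affine_linearN/ga.
split=> [i|j].
  have := sxy (inl (inl i)); have := sxy (inl (inr i)); rewrite /= fx.
  by rewrite oppr0 lexx oppr_ge0 => fy0 fy1; apply/le_anti; rewrite -fy0 -fy1.
by have := sxy (inr j); rewrite /= !oppr_ge0 !leNgt gx; case: ltP.
Qed.

Lemma semilinear_sign_determined A : semilinear_set A -> sign_determined A.
Proof.
move=> [m [B [basicB ->]]].
have [i|J [g [ga gP]]] := @sign_determined_family _ B.
  exact: basic_semilinear_sign_determined.
by exists J, g; split=> // x y sxy [i _ Bx]; exists i => //; exact: gP Bx.
Qed.

(** The sign in three values, [None] standing for zero: unlike the condition
[0 <= z], each of the three is an equation or a strict inequality. *)
Definition strict_sign (z : R) : option bool :=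
  if z == 0 then None else Some (0 < z).

Lemma strict_sign_ge0 z : (0 <= z) = (strict_sign z != Some false).
Proof. by rewrite /strict_sign; case: ltgtP. Qed.

(** Every index contributes both an equation and a strict inequality, one of
them being the trivial [0 = 0] or [0 < 1], so that the index type does not have
to be split according to [s]. *)
Lemma basic_semilinear_sign_cell (I : finType) (g : I -> 'rV[R]_n -> R^o)
    (s : I -> option bool) :
  (forall i, affine_linear (g i)) ->
  basic_semilinear_set [set x | forall i, strict_sign (g i x) = s i].
Proof.
move=> ga.
pose f0 i : 'rV[R]_n -> R^o := if s i is None then g i else fun=> 0.
pose f1 i : 'rV[R]_n -> R^o := match s i with
  | None => fun=> 1
  | Some true => g i
  | Some false => fun x => - g i x
  end.
exists #|I|, #|I|, (fun k => f0 (enum_val k)), (fun k => f1 (enum_val k)).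
split=> [k|k|].
- by rewrite /f0; case: (s _) => [b|//]; exact: affine_linear_cst.
- rewrite /f1; case: (s _) => [[]|] //; last exact: affine_linear_cst.
  exact: affine_linearN.
have cellE x i : strict_sign (g i x) = s i <-> f0 i x = 0 /\ 0 < f1 i x.
  rewrite /f0 /f1 /strict_sign; case: (s i) => [[]|] /=; rewrite ?oppr_gt0;
    case: ltgtP => g0; split=> // -[] //.
  - by move=> gx; rewrite gx ltxx in g0.
  - by move=> gx; rewrite gx ltxx in g0.
apply/seteqP; split=> x /= sx.
  by split=> k; have [] := (cellE x (enum_val k)).1 (sx _).
move=> i; rewrite -[i]enum_rankK; apply/cellE; split; [exact: sx.1|exact: sx.2].
Qed.

(** A sign cell that meets [A] lies in [A], so that [A] is the union of the cells
that it contains. *)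
Lemma sign_determined_semilinear A : sign_determined A -> semilinear_set A.
Proof.
move=> [I [g [ga gP]]].
pose cell (s : {ffun I -> option bool}) :=
  [set x | forall i, strict_sign (g i x) = s i].
pose S := {s : {ffun I -> option bool} | `[< cell s `<=` A >]}.
exists #|{: S}|, (fun k => cell (val (enum_val k))); split=> [k|].
  exact: basic_semilinear_sign_cell.
apply/seteqP; split=> [x Ax|x [k _]]; last first.
  by have /asboolP := valP (enum_val k); apply.
pose s := [ffun i => strict_sign (g i x)].
have sA : `[< cell s `<=` A >].
  apply/asboolP => y sy; apply: gP Ax => i.
  by rewrite !strict_sign_ge0 sy ffunE.
exists (enum_rank (exist _ s sA : S)) => //.
by rewrite enum_rankK /= => i; rewrite ffunE.
Qed.

End SignDetermined.

(** * Logical functions are semilinear *)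

Section LogicalSemilinear.
Context (R : realType) (n : nat) (T : finType) (G : linear_logical_graph R n T).

(** If the components of [lfun v] have the same signs at two points for every
vertex [v] with several outgoing arrows, then the points are in the same chamber
there, so they follow the same arrows. *)
Lemma logical_value_sign_determined (t : T) :
  sign_determined [set x | logical_value G x = t].
Proof.
pose g (u : {v : vertex G & 'I_(ldim v)}) : 'rV[R]_n -> R^o :=
  if (1 < #|outgoing (tag u)|)%N then fun x => lfun (tag u) x 0 (tagged u)
  else fun=> 0.
exists {v : vertex G & 'I_(ldim v)}, g; split=> [u|x y sxy].
  rewrite /g; case: ifP => [u1|_]; last exact: affine_linear_cst.
  exact/affine_linear_coord/lfun_affine.
have follows_y (a : arrow G) : follows x a -> follows y a.
  case=> [?|[a1 ax]]; [by left|right; split=> //].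
  have [/(_ a) ch _ _] := chamber_ofP a1.
  have [|_ [s sE]] := ch; first by rewrite /= inE.
  move: ax; rewrite sE /= => ax i; move: (ax i).
  have := sxy (Tagged (fun v : vertex G => 'I_(ldim v)) i).
  by rewrite /g /= a1 !ltNge => ->.
move=> /logical_valueP xt; apply/logical_valueP.
by elim: xt => [u|a u /follows_y fa _ IH]; [exact: stops_here|exact: stops_later IH].
Qed.

End LogicalSemilinear.

(** * A two-layer graph realizing a function of the chamber *)

(** Along an oriented cycle the rank would increase strictly and yet return to
its initial value. *)
Lemma ranked_no_oriented_cycle (G : digraph) (rank : vertex G -> nat) :
  (forall a : arrow G, (rank (tail a) < rank (Defs.head a))%N) ->
  no_oriented_cycle G.
Proof.
move=> rankP [//|a p] /= cyc.
pose r (b c : arrow G) := (rank (tail b) < rank (tail c))%N.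
have r_trans : transitive r by move=> b c d; exact: ltn_trans.
have : path r a (rcons p a).
  by apply: sub_path cyc => b c /eqP bc; rewrite /r -bc.
move=> /(order_path_min r_trans)/allP/(_ a).
by rewrite mem_rcons inE eqxx /r ltnn => /(_ isT).
Qed.

Section TwoLayer.
Context (R : realType) (n K : nat) (l : 'rV[R]_n -> 'rV[R]_K).

Definition sign_vector (x : 'rV[R]_n) : {ffun 'I_K -> bool} :=
  [ffun i => 0 <= l x 0 i].

(** The sign vectors of nonempty chambers; being realized by a point is decided
classically, which makes them a finite type. *)
Definition chamber_index : finType :=
  {s : {ffun 'I_K -> bool} | `[< exists x, sign_vector x = s >]}.

Lemma sign_vector_realized x : `[< exists y, sign_vector y = sign_vector x >].
Proof. by apply/asboolP; exists x. Qed.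

Definition index_of (x : 'rV[R]_n) : chamber_index :=
  exist _ (sign_vector x) (sign_vector_realized x).

Definition chamber (c : chamber_index) : set 'rV[R]_n :=
  [set x | index_of x = c].

Lemma index_of_surj (c : chamber_index) : exists x, index_of x = c.
Proof. by have /asboolP[x xc] := valP c; exists x; exact: val_inj. Qed.

Lemma chamber_inj : injective chamber.
Proof.
move=> c d cd; have [x xc] := index_of_surj c.
by have : chamber c x by []; rewrite cd => <-.
Qed.

Lemma chamberE (c : chamber_index) :
  chamber c = [set x | forall i, if val c i then 0 <= l x 0 i else l x 0 i < 0].
Proof.
apply/seteqP; split=> [x <- i|x /= xc]; first by rewrite /= ffunE; case: leP.
by apply/val_inj/ffunP => i; rewrite /= ffunE; move: (xc i); case: ifP; case: leP.
Qed.

Lemma chambersE : chambers l = range chamber.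
Proof.
apply/seteqP; split=> [C [+ [s CE]]|_ [c _ <-]].
  rewrite CE => -[x Cx]; exists (index_of x) => //; rewrite chamberE.
  suff -> : val (index_of x) = s :> ('I_K -> bool) by [].
  by apply/funext => i; rewrite /= ffunE; move: (Cx i); case: (s i); case: leP.
by split; [have [x] := index_of_surj c; exists x|exists (val c); exact: chamberE].
Qed.

Context (T : finType) (F h : chamber_index -> T).
Hypothesis l_affine : affine_linear l.
(* [h] is used only on the arrows that no walk takes, those with [d != c]; the
   hypothesis makes these arrows alone reach every target. *)
Hypothesis h_surj : forall t, exists c d : chamber_index, d != c /\ h d = t.
Hypothesis index_gt1 : (1 < #|chamber_index|)%N.

Definition two_layer_head (a : chamber_index + chamber_index * chamber_index) :
    option chamber_index + T :=
  match a with
  | inl c => inl (Some c)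
  | inr (c, d) => inr (if d == c then F c else h d)
  end.

(** Source [inl None], intermediate vertices [inl (Some c)], targets [inr t]; the
arrow [inl c] tests [l] at the source, [inr (c, d)] tests it again at the
intermediate vertex [c]. *)
Definition two_layer_digraph : digraph :=
  @Digraph (option chamber_index + T)%type
    (chamber_index + chamber_index * chamber_index)%type
    (fun a => match a with inl _ => inl None | inr (c, _) => inl (Some c) end)
    two_layer_head.

Lemma two_layer_acyclic : no_oriented_cycle two_layer_digraph.
Proof.
apply: (@ranked_no_oriented_cycle two_layer_digraph (fun v => match v with
  | inl None => 0 | inl (Some _) => 1 | inr _ => 2 end)%N).
by case=> [c|[c d]].
Qed.

Lemma two_layer_sourceP (v : vertex two_layer_digraph) :
  #|incoming v| = 0%N <-> v = inl None.
Proof.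
split=> [/cards0_eq/setP v0|->]; last first.
  by apply/eqP; rewrite cards_eq0; apply/eqP/setP => -[c|[c d]]; rewrite !inE.
case: v v0 => [[c|//]|t] v0; first by have := v0 (inl c); rewrite !inE eqxx.
have [c [d [/negPf dc ht]]] := h_surj t.
by have := v0 (inr (c, d)); rewrite !inE /= dc ht eqxx.
Qed.

(** Source and intermediate vertices behave alike, each having one arrow for every
chamber; this is their common description. *)
Definition two_layer_arrow (v : option chamber_index) (d : chamber_index) :
    arrow two_layer_digraph :=
  if v is Some c then inr (c, d) else inl d.

Lemma two_layer_arrow_inj v : injective (two_layer_arrow v).
Proof. by case: v => [c|] d e []. Qed.

Lemma outgoing_two_layer (v : option chamber_index) :
  outgoing (inl v : vertex two_layer_digraph) =
  [set two_layer_arrow v d | d in [set: chamber_index]]%SET.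
Proof.
apply/setP => a; rewrite inE; apply/eqP/imsetP => [|[d _ ->]]; last first.
  by case: v.
by case: a => [d|[c d]] [<-]; exists d.
Qed.

Lemma outgoing_target (t : T) :
  outgoing (inr t : vertex two_layer_digraph) = finset.set0.
Proof. by apply/setP => -[c|[c d]]; rewrite !inE. Qed.

Lemma card_outgoing_two_layer (v : option chamber_index) :
  #|outgoing (inl v : vertex two_layer_digraph)| = #|chamber_index|.
Proof.
rewrite outgoing_two_layer card_imset ?cardsT //; exact: two_layer_arrow_inj.
Qed.

Lemma two_layer_targetP (v : vertex two_layer_digraph) :
  #|outgoing v| = 0%N <-> exists t, v = inr t.
Proof.
split=> [|[t ->]]; last by rewrite outgoing_target cards0.
case: v => [v|t]; last by exists t.
by rewrite card_outgoing_two_layer => v0; move: index_gt1; rewrite v0.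
Qed.

Definition two_layer_chamber (a : arrow two_layer_digraph) : set 'rV[R]_n :=
  match a with inl c => chamber c | inr (_, d) => chamber d end.

Lemma two_layer_chamberE v d : two_layer_chamber (two_layer_arrow v d) = chamber d.
Proof. by case: v. Qed.

Lemma two_layer_chamberP (v : vertex two_layer_digraph) :
  (1 < #|outgoing v|)%N ->
  set_bij [set` outgoing v] (chambers l) two_layer_chamber.
Proof.
case: v => [v _|t]; last by rewrite outgoing_target cards0.
rewrite outgoing_two_layer chambersE; split.
- by move=> _ /imsetP[d _ ->]; rewrite two_layer_chamberE; exists d.
- move=> a b; rewrite !inE => /imsetP[c _ ->] /imsetP[d _ ->].
  by rewrite !two_layer_chamberE => /chamber_inj ->.
- move=> _ [d _ <-]; exists (two_layer_arrow v d); last exact: two_layer_chamberE.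
  by apply/imsetP; exists d.
Qed.

Definition two_layer_graph : linear_logical_graph R n T :=
  @LinearLogicalGraph R n T two_layer_digraph two_layer_acyclic
    (inl None) two_layer_sourceP inr (@inr_inj _ _) two_layer_targetP
    (fun=> K) (fun=> l) (fun _ _ => l_affine)
    two_layer_chamber two_layer_chamberP.

Lemma logical_value_two_layer x :
  logical_value two_layer_graph x = F (index_of x).
Proof.
apply/logical_valueP; set c := index_of x.
have follows_x v :
    @follows _ _ _ two_layer_graph x (two_layer_arrow v c).
  right; rewrite /= two_layer_chamberE; split=> //.
  by case: v => [d|]; rewrite card_outgoing_two_layer.
apply: (stops_later (follows_x None)); apply: (stops_later (follows_x (Some c))).
by rewrite /= eqxx; exact: (@stops_here _ _ _ two_layer_graph).
Qed.

End TwoLayer.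

(** * Semilinear functions are logical *)

(** With the points [p (Some t)] in distinct chambers, sending the chamber of
[p (Some t)] to [t] reaches all of [T]; the additional point [p None] provides a
chamber [c] different from that of every [p (Some t)]. *)
Lemma enough_chambers (R : realType) (n K : nat) (l : 'rV[R]_n -> 'rV[R]_K)
    (T : finType) (p : option T -> 'rV[R]_n) (T_gt0 : (0 < #|T|)%N) :
  injective (fun o => index_of l (p o)) ->
  (1 < #|chamber_index l|)%N /\
  exists h : chamber_index l -> T, forall t, exists c d, d != c /\ h d = t.
Proof.
move=> inj; split.
  by apply: leq_trans (leq_card _ inj); rewrite card_option ltnS.
have [t0 _] := card_gt0P T_gt0.
exists (fun c => odflt t0 [pick t | index_of l (p (Some t)) == c]) => t.
exists (index_of l (p None)), (index_of l (p (Some t))); split.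
  by apply/eqP => /inj.
by case: pickP => [u /eqP/inj[]|/(_ t)]; rewrite ?eqxx.
Qed.

(** The points of [D] in one chamber have the same value, whereas a chamber that
does not meet [D] may be given any value. *)
Lemma semilinear_logical (R : realType) (n : nat) (n_gt0 : (0 < n)%N)
    (D : set 'rV[R]_n) (T : finType) (T_gt0 : (0 < #|T|)%N) (f : D -> T) :
  semilinear_function f -> linear_logical_function f.
Proof.
move=> /choice[S SP].
have [t|I [g [ga gP]]] := @sign_determined_family _ _ _ S.
  by apply: semilinear_sign_determined; have [] := SP t.
have fS (x : D) t : f x = t <-> S t (val x).
  have [_ /seteqP[sub sup]] := SP t; split=> [fxt|Sx].
    by have [|] := sub (val x); first by exists x.
  have [|y /= <- /val_inj -> //] := sup (val x).
  by split=> //; exact: set_valP.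
pose i0 := Ordinal n_gt0.
(* The point [p o] below has all its coordinates equal to [rk o], so the tests
   [thr o'] separate these points from each other. *)
pose rk (o : option T) : nat := enum_rank o.
pose thr (o : option T) (x : 'rV[R]_n) : R^o := x 0 i0 - (rk o)%:R.
pose J := (I + option T)%type.
pose k (j : J) := match j with inl i => g i | inr o => thr o end.
pose l x := \row_(j < #|{: J}|) (k (enum_val j) x : R).
have l_affine : affine_linear l.
  apply: (@affine_linear_row _ _ _ (fun j => k (enum_val j))) => j.
  by case: (enum_val j) => [i|o]; [exact: ga|exact: affine_linear_subr].
have indexP x y : index_of l x = index_of l y -> same_signs k x y.
  move=> /(congr1 val)/ffunP xy j; have := xy (enum_rank j).
  by rewrite !ffunE !mxE enum_rankK.
pose p (o : option T) : 'rV[R]_n := const_mx (rk o)%:R.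
have p_inj : injective (fun o => index_of l (p o)).
  move=> o o' /indexP oo'; apply/enum_rank_inj/val_inj/eqP; rewrite eqn_leq.
  have := oo' (inr o); have := oo' (inr o').
  by rewrite /k /thr !mxE !subrr lexx !subr_ge0 !ler_nat => -> <-.
have [index_gt1 [h hP]] := enough_chambers T_gt0 p_inj.
have [t0 _] := card_gt0P T_gt0.
have /choice[F FP] (c : chamber_index l) :
    exists t, forall x : D, index_of l (val x) = c -> f x = t.
  have [[y yc]|noD] := pselect (exists y : D, index_of l (val y) = c).
    exists (f y) => x; rewrite -yc => /esym/indexP xy; apply/fS.
    by apply: (gP (val y)) => [i|]; [exact: (xy (inl i))|exact/fS].
  by exists t0 => x xc; case: noD; exists x.
exists (two_layer_graph F l_affine hP index_gt1).
by apply/funext => x; rewrite logical_value_two_layer; exact: FP.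
Qed.

Theorem theorem3p2 (R : realType) (n : nat) (n_gt0 : (0 < n)%N)
    (D : set 'rV[R]_n) (T : finType) (T_gt0 : (0 < #|T|)%N) (f : D -> T) :
  semilinear_function f <-> linear_logical_function f.
Proof.
split; first exact: semilinear_logical.
move=> [G ->] t; exists [set x | logical_value G x = t]; split.
  exact/sign_determined_semilinear/logical_value_sign_determined.
apply/seteqP; split=> [_ [x /= xt <-]|x [Dx xt]]; first by split=> //; exact: set_valP.
by exists (SigSub (mem_set Dx)).
Qed.
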